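(* Let a (discrete) group $G$ act on a connected graph $\Gamma$ by automorphisms, properly on edges (edge stabilizers are finite), and let $\mathcal U$ be a $G$-invariant visibility on $\Gamma$. Then the action of $G$ on $(\Gamma^0,\mathcal U)$ has the Dynkin property. Furthermore, the induced action of $G$ on the completion of $(\Gamma^0,\mathcal U)$ has the convergence property.
   Context: Graphs are without loops and multiple edges; $\Gamma^0,\Gamma^1$ are the sets of vertices and edges; $\mathsf d$ is the graph metric. $\mathsf S^2M$ is the set of unordered pairs (repetition allowed) of elements of $M$, $\Delta^2M$ is the set of pairs $\{x,x\}$. For $\mathbf u\subset\mathsf S^2M$ containing $\Delta^2M$, $\mathbf u^2$ is the set of pairs $\{x,y\}$ such that $\{x,z\},\{z,y\}\in\mathbf u$ for some $z$. A uniformity on $M$ is a filter $\mathcal U$ of subsets of $\mathsf S^2M$ containing $\Delta^2M$ (its elements are entourages) such that for every $\mathbf u\in\mathcal U$ there is $\mathbf v\in\mathcal U$ with $\mathbf v^2\subset\mathbf u$. A set $m\subset M$ is $\mathbf u$-small if all pairs of elements of $m$ belong to $\mathbf u$. The completion is the Hausdorff space of minimal Cauchy filters. For an edge $e$ let $\mathbf u_e=\{\{x,y\}\in\mathsf S^2\Gamma^0:\mathsf d(x,e)+\mathsf d(y,e)\ge\mathsf d(x,y)\}$, i.e. the set of pairs such that no geodesic segment joining $x$ and $y$ passes through $e$. The visibility filter $\mathrm{Vis}\,\Gamma$ is the filter on $\mathsf S^2\Gamma^0$ generated by $\{\mathbf u_e:e\in\Gamma^1\}$. A visibility on $\Gamma$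 is a uniformity $\mathcal U$ on $\Gamma^0$ with $\mathcal U\subset\mathrm{Vis}\,\Gamma$. The completion of $\Gamma^0$ with respect to a visibility is compact. Two entourages $\mathbf u,\mathbf v$ of $(M,\mathcal U)$ are unlinked if $M$ is a union of a $\mathbf u$-small set and a $\mathbf v$-small set; otherwise they are linked, written $\mathbf u\#\mathbf v$. An action of a discrete group $G$ on $M$ preserving $\mathcal U$ has the Dynkin property if for all $\mathbf u,\mathbf v\in\mathcal U$ the set $\{g\in G:\mathbf u\# g\mathbf v\}$ is finite. An action of a discrete group $G$ by homeomorphisms on a compact Hausdorff space $T$ has the convergence property if the induced action on the space $\Theta^3T$ of three-element subsets of $T$ is proper, i.e. for every compact $K\subset\Theta^3T$ the set $\{g\in G: gK\cap K\neq\varnothing\}$ is finite. *)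

(* Defs.v *)
From HB Require Import structures.
From mathcomp Require Import all_boot all_order monoid.
From mathcomp Require Import all_classical topology.

Set Implicit Arguments.
Unset Strict Implicit.
Unset Printing Implicit Defensive.

Local Open Scope classical_set_scope.
Local Open Scope group_scope.

Section Action.
Context {G : groupType} {X : Type}.
Implicit Types act : G -> X -> X.

Definition left_action act :=
  (forall x, act 1 x = x) /\ (forall g h x, act (g * h) x = act g (act h x)).

Definition pair_act act (g : G) (p : X * X) : X * X := (act g p.1, act g p.2).

Lemma actVK act g : left_action act -> cancel (act g^-1) (act g).
Proof. by move=> [act1 actM] x; rewrite -actM mulgV act1. Qed.

Lemma actKV act g : left_action act -> cancel (act g) (act g^-1).
Proof. by move=> [act1 actM] x; rewrite -actM mulVg act1. Qed.

End Action.

(* A graph on the vertex type [V] is given by its adjacency relation; without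
   loops and multiple edges, it is irreflexive and symmetric, and an edge is
   the set of its two endpoints. *)
Section Graph.
Context {V : Type}.
Implicit Types (adj : rel V) (x y : V) (e : set V).

Definition edges adj : set (set V) :=
  [set e | exists x y, adj x y /\ e = [set x; y]].

Definition connected_graph adj :=
  forall x y, exists p, path adj x p /\ last x p = y.

(* The infimum of a nonempty set of natural numbers is its least element; the
   default 0 for the empty set is never used in a connected graph. *)
Definition graph_dist adj x y : nat :=
  infimum 0%N [set n | exists p, [/\ path adj x p, last x p = y & size p = n]].

Definition edge_dist adj x e : nat := infimum 0%N (graph_dist adj x @` e).

(* The pairs joined by no geodesic segment through the edge [e]. Sets of
   unordered pairs are encoded as symmetric sets of ordered pairs; a uniformity
   is determined by its symmetric entourages, and [small] below depends only on
   the symmetric part of an entourage. *)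
Definition edge_entourage adj e : set (V * V) :=
  [set p | (graph_dist adj p.1 p.2 <=
            edge_dist adj p.1 e + edge_dist adj p.2 e)%N].

Definition visibility_filter adj : set_system (V * V) :=
  smallest (@Filter (V * V)%type) (edge_entourage adj @` edges adj).

End Graph.

Section Uniformity.
Context {M : uniformType}.
Implicit Types (u v : set (M * M)) (F : set_system M).

Definition visibility (adj : rel M) :=
  @entourage M `<=` visibility_filter adj.

Definition small u (A : set M) := A `*` A `<=` u.

Definition unlinked u v :=
  exists A B, [/\ A `|` B = [set: M], small u A & small v B].

Definition linked u v := ~ unlinked u v.

Definition preserves_uniformity (G : groupType) (act : G -> M -> M) :=
  forall g u, entourage u -> entourage (pair_act act g @` u).

Definition dynkin_property (G : groupType) (act : G -> M -> M) :=
  forall u v, entourage u -> entourage v ->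
    finite_set [set g : G | linked u (pair_act act g @` v)].

Definition cauchy_filter F := ProperFilter F /\ cauchy F.

Definition minimal_cauchy_filter F :=
  cauchy_filter F /\ forall F', cauchy_filter F' -> F' `<=` F -> F' = F.

Lemma cauchy_small F u : cauchy_filter F -> entourage u ->
  exists2 A, F A & small u A.
Proof.
move=> [FF cF] /cF[[A B] [FA FB] AB]; exists (A `&` B); first exact: filterI.
by move=> [x y] [[Ax _] [_ By]]; apply: AB.
Qed.

Lemma small_cauchy F : ProperFilter F ->
  (forall u, entourage u -> exists2 A, F A & small u A) -> cauchy_filter F.
Proof. by move=> FF H; split=> // u /H[A FA Au]; exists (A, A). Qed.

End Uniformity.

Record completion (M : uniformType) := Completion {
  completion_filter :> set_system M;
  completion_filterP : minimal_cauchy_filter completion_filter }.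

HB.instance Definition _ (M : uniformType) := gen_eqMixin (completion M).
HB.instance Definition _ (M : uniformType) := gen_choiceMixin (completion M).

Lemma completion_inj (M : uniformType) (F F' : completion M) :
  completion_filter F = completion_filter F' -> F = F'.
Proof.
by case: F F' => [F pF] [F' pF'] /= E; subst F'; rewrite (Prop_irrelevance pF pF').
Qed.

Section CompletionUniformity.
Context {M : uniformType}.

(* The entourage of the completion induced by [u]: the two filters have a
   common [u]-small member. *)
Definition completion_rel (u : set (M * M)) : set (completion M * completion M) :=
  [set p | exists A, [/\ completion_filter p.1 A, completion_filter p.2 A
                       & small u A]].

Definition completion_entourage : set_system (completion M * completion M) :=
  filter_from entourage completion_rel.

Local Lemma completion_entourage_filter : Filter completion_entourage.
Proof.
apply: filter_from_filter; first by exists setT; exact: entourageT.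
move=> u v eu ev; exists (u `&` v); first exact: filterI.
move=> [F F'] [A [/= FA F'A Auv]]; split; exists A; split=> // p Ap.
  exact: (Auv _ Ap).1.
exact: (Auv _ Ap).2.
Qed.

Local Open Scope relation_scope.

Local Lemma completion_entourage_diagonal A :
  completion_entourage A -> diagonal `<=` A.
Proof.
move=> [u eu uA] [F F'] /= FF'; apply: uA => /=; rewrite /diagonal /= in FF'.
have [B FB Bu] := cauchy_small (completion_filterP F).1 eu.
by exists B; rewrite -FF'.
Qed.

Local Lemma completion_entourage_inv A :
  completion_entourage A -> completion_entourage A^-1.
Proof.
move=> [u eu uA]; exists u => // -[F F'] [B [/= FB F'B Bu]].
by apply: uA; exists B.
Qed.

Local Lemma completion_entourage_split A : completion_entourage A ->
  exists2 B, completion_entourage B & B \; B `<=` A.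
Proof.
move=> [u eu uA]; have [v ev vu] := entourage_split_ex eu.
exists (completion_rel v); first by exists v.
move=> [F H] [K [B [/= FB KB Bv]] [C [/= KC HC Cv]]]; apply: uA.
have [[FF _] _] := completion_filterP F.
have [[FK _] _] := completion_filterP K.
have [[FH _] _] := completion_filterP H.
have [z [Bz Cz]] : B `&` C !=set0 by apply: (@filter_ex _ K); exact: filterI.
exists (B `|` C); split => /=.
- by apply: filterS FB => x; left.
- by apply: filterS HC => x; right.
move=> [x y] [/= [Bx|Cx] [By|Cy]]; apply: vu.
- by exists y; [apply: Bv|apply: Bv].
- by exists z; [apply: Bv|apply: Cv].
- by exists z; [apply: Cv|apply: Bv].
- by exists y; [apply: Cv|apply: Cv].
Qed.

HB.instance Definition _ := isUniform.Build (completion M)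
  completion_entourage_filter completion_entourage_diagonal
  completion_entourage_inv completion_entourage_split.

End CompletionUniformity.

Section CompletionAction.
Context {G : groupType} {M : uniformType} {act : G -> M -> M}.
Hypotheses (actA : left_action act) (actU : preserves_uniformity act).

Local Lemma act_cauchy_filter g (F : set_system M) :
  cauchy_filter F -> cauchy_filter (act g @ F).
Proof.
move=> cF; have [FF _] := cF.
apply: small_cauchy => u eu.
have [A FA Au] := cauchy_small cF (actU g^-1 eu).
exists (act g @` A).
  by rewrite /fmap /=; apply: filterS FA => x Ax; exists x.
move=> [x y] [/= [a Aa <-] [b Ab <-]].
by have [[c d] ucd [<- <-]] := Au (a, b) (conj Aa Ab); rewrite !(actVK g actA).
Qed.

Local Lemma act_minimal_cauchy_filter g (F : completion M) :
  minimal_cauchy_filter (act g @ completion_filter F).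
Proof.
have [cF minF] := completion_filterP F.
split=> [|F' cF' F'F]; first exact: act_cauchy_filter.
have E : act g^-1 @ F' = completion_filter F.
  apply: minF; first exact: act_cauchy_filter.
  move=> A /F'F; rewrite /fmap /= => FA.
  have [FF _] := cF; apply: filterS FA.
  by move=> x /=; rewrite (actKV g actA).
have act_preimageK A : act g^-1 @^-1` (act g @^-1` A) = A.
  by apply/seteqP; split=> x /=; rewrite (actVK g actA).
apply/seteqP; split=> [//|A]; rewrite -E.
by move=> FA; rewrite -(act_preimageK A).
Qed.

Definition completion_act (g : G) (F : completion M) : completion M :=
  Completion (act_minimal_cauchy_filter g F).

End CompletionAction.

Section Theta3.
Context {T : Type}.

Definition distinct_triples : set (T * T * T) :=
  [set t | [/\ t.1.1 <> t.1.2, t.1.2 <> t.2 & t.1.1 <> t.2]].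

Definition triple_set (t : T * T * T) : set T := [set t.1.1; t.1.2; t.2].

End Theta3.

(* The space of three-element subsets, with the quotient topology of the
   subspace of ordered triples of distinct points. *)
Record theta3 (T : Type) := Theta3 {
  theta3_set :> set T;
  theta3_setP : (triple_set @` distinct_triples) theta3_set }.

HB.instance Definition _ (T : Type) := gen_eqMixin (theta3 T).
HB.instance Definition _ (T : Type) := gen_choiceMixin (theta3 T).

Section Theta3Topology.
Context {T : topologicalType}.

Definition theta3_of (t : @distinct_triples T) : theta3 T :=
  Theta3 (imageP triple_set (set_valP t)).

Definition theta3_open : set_system (theta3 T) :=
  [set U | open (theta3_of @^-1` U)].

Local Lemma theta3_openT : theta3_open setT.
Proof. by rewrite /theta3_open /= preimage_setT; exact: openT. Qed.

Local Lemma theta3_openI : setI_closed theta3_open.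
Proof. by move=> U V oU oV; exact: openI. Qed.

Local Lemma theta3_open_bigU (I : Type) (f : I -> set (theta3 T)) :
  (forall i, theta3_open (f i)) -> theta3_open (\bigcup_i f i).
Proof. by move=> fo; apply: bigcup_open => i _; exact: fo. Qed.

HB.instance Definition _ := isOpenTopological.Build (theta3 T)
  theta3_openT theta3_openI theta3_open_bigU.

End Theta3Topology.

(* The notion applies to actions by homeomorphisms on a compact Hausdorff space,
   which is made part of the predicate. The action of [g] on [theta3 T] is the
   pointwise action on subsets, so [g K] meets [K] when [act g @` A = B] for some
   [A] and [B] in [K]. *)
Definition convergence_property (G : groupType) (T : topologicalType)
    (act : G -> T -> T) :=
  [/\ compact [set: T], hausdorff_space T, left_action act,
      forall g, continuous (act g) &
      forall K : set (theta3 T), compact K ->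
        finite_set [set g : G | exists A B : theta3 T,
          [/\ K A, K B & act g @` A = B]]].

(* Main.v *)
Require Import Defs.
From mathcomp Require Import all_boot all_order monoid.
From mathcomp Require Import finmap.
From mathcomp Require Import all_classical topology.

Set Implicit Arguments.
Unset Strict Implicit.
Unset Printing Implicit Defensive.

Local Open Scope classical_set_scope.

(** Write [d] for the graph distance and [g w] for the translate of an
    entourage [w] by [g].

    Two features of the visibility filter carry the proof, and both are read
    off the generators, since each defines a filter containing them.
    - Every [w] in the visibility filter has a finite set [S] of vertices, the
      endpoints of the edges that define [w], such that [w (x, y)] holds as
      soon as [y] is at least as near to [x] as every point of [S]
      ([visibility_filter_witness]): a geodesic from [x] to [y] through an edge
      passes strictly nearer to [x] before it reaches [y].
    - An edge [e'] belongs to [u_e] unless [e' = e]. As edge stabilizers are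
      finite, a given edge has [w]-small images under all but finitely many
      [g], and chaining entourages along a path gives the same for any two
      vertices ([entourage_orbit_finite]).

    Dynkin property ([visibility_dynkin]). Given entourages [u] and [v], take a
    symmetric entourage [w] whose triple composite lies in both, and [S] as
    above. For all but finitely many [g], both [g S] is [w]-small and [S] is
    [g w]-small. For such a [g], let [A] be the points [w]-close to [g S] and
    [B] the points [g w]-close to [S]; these are [u]-small and [g v]-small. They
    cover: if the point of [g S] nearest to [x] is at least as near as all of
    [S], it is [w]-close to [x]; otherwise the point of [S] nearest to [x] is at
    least as near as all of [g S], hence [g w]-close to [x].

    The completion. Taking for [y] the point of [S] nearest to [x] shows that the
    uniformity is totally bounded, so its completion is compact
    ([completion_compact]); it is Hausdorff since two minimal Cauchy filters
    with common small members contain the Cauchy filter which is their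
    intersection.

    Convergence ([dynkin_convergence]). The triples in a compact set [K] are
    uniformly separated, say by the entourage of the completion induced by [u]
    ([compact_theta3_separated]). If [g] maps a triple of [K] to a triple of [K]
    while [v] and [g v] are unlinked, where the triple composite of [v] lies in
    [u], then a cover by a [v]-small set [P] and a [g v]-small set [Q] leads to
    a contradiction: each of the three image points is adherent to [P] or to
    [Q], so two of them share one of the sets; sharing [P] makes the two image
    points [u]-close, sharing [Q] makes their preimages [u]-close. So all such
    [g] have [v] linked with [g v], and by the Dynkin property they are finitely
    many. *)

(** * Entourages, least elements and filters *)

Lemma entourage_sym_split3 (M : uniformType) (u : set (M * M)) : entourage u ->
  exists v, [/\ entourage v, forall x y, v (x, y) -> v (y, x) &
    forall x y z t, v (x, y) -> v (y, z) -> v (z, t) -> u (x, t)].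
Proof.
move=> eu; pose w := split_ent (split_ent u).
have ew : entourage w by do 2!apply: entourage_split_ent.
exists (w `&` w^-1%relation); split; first exact: entourage_invI.
  by move=> x y [].
move=> x y z t [xy _] [yz _] [zt _]; apply: (entourage_split z) => //.
  exact: (entourage_split y).
by apply: split_ent_subset => //; exact: entourage_split_ent.
Qed.

Lemma natset_min (A : set nat) : A !=set0 -> exists2 n, A n & lbound A n.
Proof.
move=> [k Ak]; have ex : exists n, `[< A n >] by exists k; apply/asboolP.
case: (ex_minnP ex) => n /asboolP An min_n.
by exists n => // m Am; rewrite leEnat; apply: min_n; apply/asboolP.
Qed.

Lemma nearest_point (T : Type) (f : T -> nat) (S : set T) : S !=set0 ->
  exists2 s, S s & forall t, S t -> (f s <= f t)%N.
Proof.
move=> [s0 Ss0]; have [|n [s Ss <-] min_s] := @natset_min (f @` S).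
  by exists (f s0), s0.
by exists s => // t St; have := min_s (f t); rewrite leEnat; apply; exists t.
Qed.

Lemma infimum_nat (A : set nat) : A !=set0 ->
  A (infimum 0%N A) /\ lbound A (infimum 0%N A).
Proof.
move=> A0; have [n An min_n] := natset_min A0.
have infn : infimums A n by split=> // m; apply.
suff -> : infimum 0%N A = n by [].
rewrite /infimum; case: ifPn => [/eqP A_0|_]; first by rewrite A_0 in An.
by apply: xget_subset1 => //; exact: is_subset1_infimums.
Qed.

(** A filter whose members all meet [P] lies below a proper filter containing
    [P]; so this is the prime property of ultrafilters, read on [F]. *)
Lemma proper_meetsU (T : Type) (F : set_system T) (P Q : set T) :
  ProperFilter F -> P `|` Q = [set: T] ->
  (forall D, F D -> D `&` P !=set0) \/ (forall D, F D -> D `&` Q !=set0).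
Proof.
move=> FF PQ; apply: contrapT => /not_orP [nP nQ].
apply: nP => D FD; apply: contrapT => DP; apply: nQ => E FE.
apply: contrapT => EQ; have [x [Dx Ex]] := filter_ex (filterI FD FE).
have : (P `|` Q) x by rewrite PQ.
by case=> [Px|Qx]; [apply: DP; exists x|apply: EQ; exists x].
Qed.

Lemma ultra_finite_cover (T : Type) (I : choiceType) (U : set_system T)
    (S : set I) (P : I -> set T) : UltraFilter U -> finite_set S ->
  (forall x, exists2 i, S i & P i x) -> exists2 i, S i & U (P i).
Proof.
move=> UU fS cover; apply: contrapT => none.
have /finite_fsetP [X SX] := fS.
have : U (\bigcap_(i in [set` X]) ~` P i).
  apply: filter_bigI => i iX; have [UP|//] := in_ultra_setVsetC (P i) UU.
  by exfalso; apply: none; exists i => //; rewrite SX.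
move=> /filter_ex [x xP]; have [i Si Pix] := cover x.
by apply: (xP i) => //; rewrite -SX.
Qed.

Lemma pigeonhole3 (T : Type) (t : T * T * T) (p q : T -> Prop) :
  distinct_triples t -> (forall x, p x \/ q x) ->
  exists x y, [/\ triple_set t x, triple_set t y, x <> y &
    (p x /\ p y) \/ (q x /\ q y)].
Proof.
case: t => [[a b] c] [/= ab bc ac] pq.
have Ta : triple_set (a, b, c) a by left; left.
have Tb : triple_set (a, b, c) b by left; right.
have Tc : triple_set (a, b, c) c by right.
case: (pq a) (pq b) (pq c) => [pa|qa] [pb|qb] [pc|qc].
- by exists a, b; split=> //; left.
- by exists a, b; split=> //; left.
- by exists a, c; split=> //; left.
- by exists b, c; split=> //; right.
- by exists b, c; split=> //; left.
- by exists a, c; split=> //; right.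
- by exists a, b; split=> //; right.
- by exists a, b; split=> //; right.
Qed.

(** * Graph distance *)

Section Graph.
Context {V : Type} (adj : rel V).
Hypothesis adj_conn : connected_graph adj.
Local Notation d := (graph_dist adj).

Lemma graph_distP x y : exists p, [/\ path adj x p, last x p = y & size p = d x y].
Proof.
have [p [xp py]] := adj_conn x y.
suff [] : [set n | exists p, [/\ path adj x p, last x p = y & size p = n]] (d x y)
  by move=> q; exists q.
by apply: (infimum_nat _).1; exists (size p), p.
Qed.

Lemma graph_dist_le x p : path adj x p -> (d x (last x p) <= size p)%N.
Proof.
move=> xp; have [|_] := @infimum_nat
    [set n | exists q, [/\ path adj x q, last x q = last x p & size q = n]].
  by exists (size p), p.
by move=> /(_ (size p)); rewrite leEnat; apply; exists p.
Qed.

Lemma graph_dist_eq0 x y : d x y = 0%N -> x = y.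
Proof. by have [[|? ?] [_ <- <-]] := graph_distP x y. Qed.

Lemma graph_distxx x : d x x = 0%N.
Proof. by apply/eqP; rewrite -leqn0; exact: (@graph_dist_le x [::]). Qed.

Lemma edge_distP x e : e !=set0 -> exists2 s, e s & edge_dist adj x e = d x s.
Proof.
move=> [s es]; have [|[t et dt] _] := @infimum_nat (d x @` e).
  by exists (d x s), s.
by exists t.
Qed.

Lemma graph_dist_act_le f x y : (forall x y, adj (f x) (f y) = adj x y) ->
  (d (f x) (f y) <= d x y)%N.
Proof.
move=> fadj; have [p [xp <- <-]] := graph_distP x y.
rewrite -last_map -(size_map f) graph_dist_le //.
by rewrite path_map (eq_path (e' := adj)).
Qed.

(** The sets [w] with such an [S] form a filter, and the endpoints of [e] serve
    for [u_e]: the distance from [x] to [e] is attained at one of them. *)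
Lemma visibility_filter_witness w : visibility_filter adj w ->
  exists2 S : set V, finite_set S &
    forall x y, (forall s, S s -> (d x y <= d x s)%N) -> w (x, y).
Proof.
pose W : set_system (V * V) := [set w | exists2 S : set V, finite_set S &
    forall x y, (forall s, S s -> (d x y <= d x s)%N) -> w (x, y)].
suff : visibility_filter adj `<=` W by move=> /[apply].
apply: smallest_sub.
  split.
  - by exists set0.
  - move=> u v [S fS Su] [T fT Tv]; exists (S `|` T); first by rewrite finite_setU.
    by move=> x y xyST; split; [apply: Su|apply: Tv] => s ?; apply: xyST; [left|right].
  - by move=> u v uv [S fS Su]; exists S => // x y /Su/uv.
move=> _ [_ [a [b [_ ->]] <-]]; exists [set a; b]; first exact: finite_set2.
move=> x y xye; rewrite /edge_entourage /=.
have [|s es ->] := @edge_distP x [set a; b]; first by exists a; left.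
exact: leq_trans (xye s es) (leq_addr _ _).
Qed.

End Graph.

(** * The Dynkin property *)

Section Dynkin.
Context {G : groupType} {M : uniformType} {adj : rel M} {act : G -> M -> M}.
Hypothesis adj_conn : connected_graph adj.
Hypothesis actA : left_action act.
Hypothesis act_adj : forall g x y, adj (act g x) (act g y) = adj x y.
Hypothesis act_proper : forall e, edges adj e ->
  finite_set [set g : G | act g @` e = e].
Hypothesis vis : visibility adj.
Local Notation d := (graph_dist adj).

Lemma graph_dist_act g x y : d (act g x) (act g y) = d x y.
Proof.
apply/eqP; rewrite eqn_leq !graph_dist_act_le //=; try exact: act_adj.
have := graph_dist_act_le adj_conn (f := act g^-1%g) (act g x) (act g y).
by rewrite !(actKV g actA); apply; exact: act_adj.
Qed.

(** A nonempty transporter is a coset of the stabilizer of [e]. *)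
Lemma finite_edge_transporter e e' : edges adj e ->
  finite_set [set g : G | act g @` e = e'].
Proof.
move=> /act_proper fe.
have [[h he]|none] := pselect (exists h : G, act h @` e = e'); last first.
  by rewrite (_ : mkset _ = set0) // -subset0 => g ge; apply: none; exists g.
apply: sub_finite_set (finite_image (fun g => (h * g)%g) fe) => g ge.
exists (h^-1 * g)%g; last by rewrite mulgA mulgV mul1g.
rewrite /= (_ : act (h^-1 * g)%g = act h^-1%g \o act g); last first.
  by apply/funext => x; exact: actA.2.
rewrite -image_comp ge -he image_comp (_ : act h^-1%g \o act h = id) ?image_id //.
by apply/funext => x; exact: actKV.
Qed.

(** Endpoints at distance at most 1 which are separated by [e] must both be at
    distance 0 from [e]. *)
Lemma edge_entourage_adj a b e : edges adj e -> adj a b ->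
  ~ edge_entourage adj e (a, b) -> e = [set a; b].
Proof.
move=> [p [q [pq ->]]] ab /negP; rewrite -ltnNge /= => lt_ab.
have le1 : (d a b <= 1)%N.
  by apply: (@graph_dist_le _ _ a [:: b]); rewrite /= ab.
have e0 : [set p; q] !=set0 by exists p; left.
have := leq_trans lt_ab le1; rewrite ltnS leqn0 addn_eq0 => /andP[/eqP a0 /eqP b0].
have ea : [set p; q] a.
  have [s es] := edge_distP adj a e0; rewrite a0 => /esym.
  by move=> /(graph_dist_eq0 adj_conn) ->.
have eb : [set p; q] b.
  have [s es] := edge_distP adj b e0; rewrite b0 => /esym.
  by move=> /(graph_dist_eq0 adj_conn) ->.
have neq_ab : a <> b by move=> E; rewrite E graph_distxx in lt_ab.
case: ea eb neq_ab => [->|->] [->|->] // _; exact: setUC.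
Qed.

(** The sets [w] with this property form a filter; for [u_e] only the elements
    carrying the edge [{a, b}] to [e] can be exceptional. *)
Lemma visibility_filter_finite_adj w a b : visibility_filter adj w -> adj a b ->
  finite_set [set g : G | ~ w (act g a, act g b)].
Proof.
move=> + ab.
pose W : set_system (M * M) := [set w |
  finite_set [set g : G | ~ w (act g a, act g b)]].
suff : visibility_filter adj `<=` W by apply.
apply: smallest_sub.
  split; rewrite /W /=.
  - by rewrite (_ : mkset _ = set0) // -subset0 => g; apply.
  - move=> u v fu fv.
    have : finite_set ([set g : G | ~ u (act g a, act g b)] `|`
                       [set g : G | ~ v (act g a, act g b)]).
      by rewrite finite_setU.
    by apply: sub_finite_set => g /= /not_andP.
  - by move=> u v uv; apply: sub_finite_set => g /=; apply: contra_not; exact: uv.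
move=> _ [e ee <-]; rewrite /W /=.
have eab : edges adj [set a; b] by exists a, b.
have := @finite_edge_transporter _ e eab; apply: sub_finite_set => g /= ng.
rewrite (@edge_entourage_adj (act g a) (act g b) e) //; last by rewrite act_adj.
by rewrite image_setU !image_set1.
Qed.

(** Along a path from [a] to [b], the exceptional elements for [w] are exceptional
    for a finer entourage on some edge. *)
Lemma entourage_orbit_finite w a b : entourage w ->
  finite_set [set g : G | ~ w (act g a, act g b)].
Proof.
move=> ew; have [p [ap <-]] := adj_conn a b.
elim: p a w ew ap => [|c p IHp] a w ew /=.
  move=> _; rewrite (_ : mkset _ = set0) // -subset0 => g; apply.
  exact: entourage_refl.
move=> /andP[ac cp]; have ev := entourage_split_ent ew.
have fac := visibility_filter_finite_adj (vis ev) ac.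
have fU : finite_set ([set g : G | ~ split_ent w (act g a, act g c)] `|`
    [set g : G | ~ split_ent w (act g c, act g (last c p))]).
  by rewrite finite_setU; split=> //; exact: IHp.
apply: sub_finite_set fU => g /= ng.
by apply/not_andP => -[? ?]; apply: ng; exact: (entourage_split (act g c)).
Qed.

Lemma entourage_act_finite w (S : set M) : entourage w -> finite_set S ->
  finite_set [set g : G | exists s t, [/\ S s, S t & ~ w (act g s, act g t)]].
Proof.
move=> ew fS.
have : finite_set (\bigcup_(s in S) \bigcup_(t in S)
    [set g : G | ~ w (act g s, act g t)]).
  apply: bigcup_finite => // s _; apply: bigcup_finite => // t _.
  exact: entourage_orbit_finite.
by apply: sub_finite_set => g [s [t [Ss St ng]]]; exists s => //; exists t.
Qed.

(** The nonemptiness of [S] is asserted only in the presence of a point [x],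
    because the graph may have no vertices. *)
Lemma entourage_nearest w : entourage w -> exists2 S : set M, finite_set S &
  forall x, S !=set0 /\
    forall y, (forall s, S s -> (d x y <= d x s)%N) -> w (x, y).
Proof.
move=> ew; have [S fS Sw] := visibility_filter_witness (vis ew).
have [[x0 _]|M0] := pselect ([set: M] !=set0); last first.
  by exists S => // x; exfalso; apply: M0; exists x.
exists (x0 |` S); first by rewrite finite_setU; split=> //; exact: finite_set1.
move=> x; split; first by exists x0; left.
by move=> y xyS; apply: Sw => s Ss; apply: xyS; right.
Qed.

Lemma visibility_totally_bounded w : entourage w ->
  exists2 S : set M, finite_set S & forall x, exists2 s, S s & w (s, x).
Proof.
move=> ew; have [S fS Sw] := entourage_nearest (entourage_inv ew).
exists S => // x; have [S0 xS] := Sw x.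
by have [s Ss smin] := nearest_point (d x) S0; exists s => //; exact: xS.
Qed.

(** The witnesses are neighbourhoods of [g S] and of [S]; that they cover is a
    comparison of the points of [g S] and of [S] nearest to a given [x]. *)
Lemma visibility_dynkin : dynkin_property act.
Proof.
move=> u v eu ev.
have [w [ew wsym w3]] := entourage_sym_split3 (filterI eu ev).
have [S fS Sw] := entourage_nearest ew.
pose D := [set g : G | exists s t, [/\ S s, S t & ~ w (act g s, act g t)]].
have fD : finite_set D by exact: entourage_act_finite.
have : finite_set (D `|` (fun g => g^-1)%g @` D).
  by rewrite finite_setU; split=> //; exact: finite_image.
apply: sub_finite_set => g; apply: contraPP => nDg; apply; rewrite /unlinked.
have wS s t : S s -> S t -> w (act g s, act g t).
  by move=> Ss St; apply: contrapT => ng; apply: nDg; left; exists s, t.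
have wSV s t : S s -> S t -> w (act g^-1%g s, act g^-1%g t).
  move=> Ss St; apply: contrapT => ng; apply: nDg; right.
  by exists g^-1%g; [exists s, t|exact: invgK].
exists [set x | exists2 s, S s & w (x, act g s)],
       [set x | exists2 s, S s & w (act g^-1%g x, act g^-1%g s)].
split.
- apply/seteqP; split=> // x _.
  have [S0 xS] := Sw x.
  have [s Ss smin] := nearest_point (fun s => d x (act g s)) S0.
  have [t St tmin] := nearest_point (d x) S0.
  (* The nearer of the two nearest points decides which set contains x. *)
  have [st|/ltnW ts] := leqP (d x (act g s)) (d x t).
    by left; exists s => //; apply: xS => r /tmin; exact: leq_trans.
  right; exists t => //; apply: (Sw _).2 => r /smin; rewrite graph_dist_act.
  move=> sr; apply: leq_trans ts _; apply: leq_trans sr _.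
  by rewrite -(graph_dist_act g _ r) (actVK g actA).
- move=> [x y] [/= [s Ss xs] [t St yt]].
  by apply: (w3 _ _ _ _ xs (wS _ _ Ss St) (wsym _ _ yt)).1.
- move=> [x y] [/= [s Ss xs] [t St yt]]; exists (act g^-1%g x, act g^-1%g y).
    exact: (w3 _ _ _ _ xs (wSV _ _ Ss St) (wsym _ _ yt)).2.
  by rewrite /pair_act /= !(actVK g actA).
Qed.

End Dynkin.

(** * Uniform separation on compact sets of triples *)

Section Separation.
Context {T : uniformType}.

Definition separated (u : set (T * T)) (A : set T) :=
  forall x y, A x -> A y -> x <> y -> ~ u (x, y).

Lemma hausdorff_entourage : (forall x y : T, (forall u, entourage u -> u (x, y)) ->
  x = y) -> hausdorff_space T.
Proof. by move=> sepT x y; rewrite -closeEnbhs entourage_close => /sepT. Qed.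

Lemma hausdorff_separate (x y : T) : hausdorff_space T -> x <> y ->
  exists2 u, entourage u & nbhs (x, y) (~` u).
Proof.
move=> hT xy.
have [u eu nu] : exists2 u, entourage u & ~ u (x, y).
  apply: contrapT => nsep; apply: xy; apply: hT; rewrite -closeEnbhs entourage_close.
  by move=> u eu; apply: contrapT => nu; apply: nsep; exists u.
have [v [ev vsym v3]] := entourage_sym_split3 eu.
exists v => //; exists (xsection v x, xsection v y); first by split; exact: nbhs_entourage.
move=> [a b] [/= /xsectionP xa /xsectionP yb] ab; apply: nu.
exact: v3 xa ab (vsym _ _ yb).
Qed.

(** Asking that a neighbourhood of each pair avoid [u] makes the condition open;
    merely asking that [u] miss the pairs does not, as [u] need not be closed. *)
Definition open_separated (u : set (T * T)) : set (theta3 T) :=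
  [set A : theta3 T | forall x y : T,
    theta3_set A x -> theta3_set A y -> x <> y -> nbhs (x, y) (~` u)].

(** The topology of [theta3 T] being a quotient of that of the ordered triples,
    the condition is checked there, where it concerns six pairs of coordinates. *)
Lemma open_separated_open u : open (open_separated u).
Proof.
suff : open (theta3_of @^-1` open_separated u) by [].
rewrite openE => t usep; rewrite /interior.
have tD := set_valP t.
have cval : continuous (set_val : @distinct_triples T -> T * T * T).
  exact: initial_continuous.
pose p1 (s : @distinct_triples T) := (set_val s).1.1.
pose p2 (s : @distinct_triples T) := (set_val s).1.2.
pose p3 (s : @distinct_triples T) := (set_val s).2.
have c1 : continuous p1.
  by move=> s; apply: (cvg_comp _ _ (cvg_comp _ _ (cval s) cvg_fst) cvg_fst).
have c2 : continuous p2.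
  by move=> s; apply: (cvg_comp _ _ (cvg_comp _ _ (cval s) cvg_fst) cvg_snd).
have c3 : continuous p3.
  by move=> s; apply: (cvg_comp _ _ (cval s) cvg_snd).
have near_pair (p q : @distinct_triples T -> T) : continuous p -> continuous q ->
    triple_set (set_val t) (p t) -> triple_set (set_val t) (q t) -> p t <> q t ->
    \forall s \near t, nbhs (p s, q s) (~` u).
  move=> cp cq tp tq pq.
  have cpq : (p s, q s) @[s --> t] --> (p t, q t) := cvg_pair (cp t) (cq t).
  suff : nbhs (p t, q t) [set z | nbhs z (~` u)] by move/cpq.
  by apply: nbhs_interior; exact: usep.
have [t1 t2 t3] : [/\ triple_set (set_val t) (p1 t), triple_set (set_val t) (p2 t)
    & triple_set (set_val t) (p3 t)] by split; [left; left|left; right|right].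
have [t12 t23 t13] := tD.
near=> s => x y /= [[->|->]|->] [[->|->]|->] // _; near: s; apply: near_pair => //;
  exact: nesym.
Unshelve. all: by end_near. Qed.

Lemma theta3_open_separated (A : theta3 T) : hausdorff_space T ->
  exists2 u, entourage u & open_separated u A.
Proof.
move=> hT; have [[[a b] c] abc EA] := theta3_setP A.
have [ab bc ac] := abc; rewrite /= in ab bc ac.
have [u1 e1 n1] := hausdorff_separate hT ab.
have [u2 e2 n2] := hausdorff_separate hT bc.
have [u3 e3 n3] := hausdorff_separate hT ac.
have [u4 e4 n4] := hausdorff_separate hT (nesym ab).
have [u5 e5 n5] := hausdorff_separate hT (nesym bc).
have [u6 e6 n6] := hausdorff_separate hT (nesym ac).
exists (u1 `&` u2 `&` u3 `&` u4 `&` u5 `&` u6); first by do 5!apply: filterI => //.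
have sub (v : set (T * T)) (z : T * T) :
    u1 `&` u2 `&` u3 `&` u4 `&` u5 `&` u6 `<=` v -> nbhs z (~` v) ->
    nbhs z (~` (u1 `&` u2 `&` u3 `&` u4 `&` u5 `&` u6)).
  by move=> uv; apply: filterS => t nv /uv.
by move=> x y; rewrite -EA => -[[->|->]|->] [[->|->]|->] // _;
  [apply: sub n1|apply: sub n3|apply: sub n4|apply: sub n2|apply: sub n6
  |apply: sub n5] => z [[[[[]]]]].
Qed.

Lemma compact_theta3_separated (K : set (theta3 T)) : hausdorff_space T ->
  compact K -> exists2 u, entourage u & forall A, K A -> separated u A.
Proof.
move=> hT /compact_near_coveringP cK.
pose F := filter_from (@entourage T) (fun u => [set v | v `<=` u]).
have FF : Filter F.
  apply: filter_from_filter; first by exists setT; exact: entourageT.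
  move=> u v eu ev; exists (u `&` v); first exact: filterI.
  by move=> w wuv; split=> z /wuv [].
have [|u eu uK] := cK _ F (fun u A => separated u A) FF; last by exists u => //; exact: uK.
move=> A _; have [u eu uA] := theta3_open_separated A hT.
exists (open_separated u, [set v | v `<=` u]) => /=.
  split; last by exists u.
  by apply: open_nbhs_nbhs; split=> //; exact: open_separated_open.
move=> [B v] [/= uB vu] x y Bx By xy /vu.
exact: nbhs_singleton (uB x y Bx By xy).
Qed.

End Separation.

(** * The completion *)

Section Completion.
Context {M : uniformType}.
Implicit Types (F H : completion M).

#[local] Instance completion_proper F : ProperFilter (completion_filter F).
Proof. exact: (completion_filterP F).1.1. Qed.

Lemma completion_small F u : entourage u -> exists2 A, completion_filter F A & small u A.
Proof. exact: cauchy_small (completion_filterP F).1. Qed.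

Lemma completion_hausdorff : hausdorff_space (completion M).
Proof.
apply: hausdorff_entourage => F H FH; apply: completion_inj.
have FFH : ProperFilter (completion_filter F `&` completion_filter H).
  split; first by move=> [/filter_not_empty].
  split; first by split; exact: filterT.
    by move=> A B [? ?] [? ?]; split; exact: filterI.
  by move=> A B AB [FA HA]; split; [move: FA|move: HA]; exact: filterS.
have cFH : cauchy_filter (completion_filter F `&` completion_filter H).
  apply: small_cauchy => u eu.
  have [|A [FA HA Au]] := FH (completion_rel u); first by exists u.
  by exists A.
transitivity (completion_filter F `&` completion_filter H).
  by apply/esym/(completion_filterP F).2 => // A [].
by apply: (completion_filterP H).2 => // A [].
Qed.

(** Two points of the completion adherent to one small set [P] are close: small
    members of the two filters are glued along [P]. *)
Lemma meets_small_rel u v (F H : completion M) P :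
  entourage v -> (forall x y z t, v (x, y) -> v (y, z) -> v (z, t) -> u (x, t)) ->
  small v P -> (forall D, completion_filter F D -> D `&` P !=set0) ->
  (forall D, completion_filter H D -> D `&` P !=set0) -> completion_rel u (F, H).
Proof.
move=> ev v3 Pv FP HP.
have [A FA Av] := completion_small F ev; have [B HB Bv] := completion_small H ev.
have [p [Ap Pp]] := FP _ FA; have [q [Bq Pq]] := HP _ HB.
have vr z := entourage_refl z ev.
exists (A `|` B); split=> /=.
- by apply: filterS FA => x; left.
- by apply: filterS HB => x; right.
move=> [x y] [/= [Ax|Bx] [Ay|By]].
- exact: v3 (Av (x, y) (conj Ax Ay)) (vr y) (vr y).
- exact: v3 (Av (x, p) (conj Ax Ap)) (Pv (p, q) (conj Pp Pq)) (Bv (q, y) (conj Bq By)).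
- exact: v3 (Bv (x, q) (conj Bx Bq)) (Pv (q, p) (conj Pq Pp)) (Av (p, y) (conj Ap Ay)).
- exact: v3 (Bv (x, y) (conj Bx By)) (vr y) (vr y).
Qed.

(** A small member [C] of a coarser Cauchy filter [F'] meets [B], hence lies in
    the [u]-neighbourhood of [B]. *)
Lemma minimal_cauchy_round (F : set_system M) : cauchy_filter F ->
  (forall A, F A -> exists B u, [/\ F B, entourage u &
     forall x y, B x -> u (x, y) -> A y]) ->
  minimal_cauchy_filter F.
Proof.
move=> cF rF; split=> // F' cF' F'F; apply/seteqP; split=> // A.
move=> /rF [B [u [FB eu BuA]]]; have [C F'C Cu] := cauchy_small cF' eu.
have [FF _] := cF; have [FF' _] := cF'.
have [z [Bz Cz]] : B `&` C !=set0
  by apply: (@filter_ex _ F); apply: filterI => //; exact: F'F.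
by apply: filterS F'C => y Cy; apply: BuA Bz _; exact: Cu.
Qed.

(** An ultrafilter [U] on the completion induces a filter [F0] on [M], generated
    by the sets [N u P] which gather the [u]-small members of the filters in
    [P]. Total boundedness makes [F0] Cauchy. Enlarging the sets [N v P] by a
    smaller entourage stays within [N u P], so [F0] is round, hence minimal: it
    is a point of the completion, and the limit of [U]. *)
Lemma completion_compact :
  (forall u, entourage u ->
     exists2 S : set M, finite_set S & forall x, exists2 s, S s & u (s, x)) ->
  compact [set: completion M].
Proof.
move=> tb; rewrite compact_ultra => U UU _.
pose N (u : set (M * M)) (P : set (completion M)) : set M :=
  [set x | exists H A, [/\ P H, completion_filter H A, small u A & A x]].
pose F0 : set_system M := filter_from [set uP | entourage uP.1 /\ U uP.2]
  (fun uP => N uP.1 uP.2).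
have FF0 : ProperFilter F0.
  apply: filter_from_proper.
    apply: filter_from_filter.
      by exists (setT, setT); split=> /=; [exact: entourageT|exact: filterT].
    move=> [u P] [v Q] [/= eu UP] [/= ev UQ]; exists (u `&` v, P `&` Q) => /=.
      by split; exact: filterI.
    move=> x [H [A [/= [PH QH] HA Auv Ax]]]; split; exists H, A; split=> //.
      by move=> z /Auv [].
    by move=> z /Auv [].
  move=> [u P] [/= eu /filter_ex [H PH]].
  have [A HA Au] := completion_small H eu.
  by have [x Ax] := filter_ex HA; exists x, H, A.
have smallF0 u : entourage u -> exists v P,
    [/\ entourage v, U P, small u (N v P) &
        forall H, P H -> completion_filter H (N v P)].
  move=> eu; have [v [ev _ v3]] := entourage_sym_split3 eu.
  have [w [ew wsym w3]] := entourage_sym_split3 ev.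
  have [q [eq _ q3]] := entourage_sym_split3 ew.
  have [S fS Sq] := tb q eq.
  (* The points whose filter contains a given w-ball cover the completion when
     the center runs over S, so U contains one of these sets. *)
  have [s Ss UPs] : exists2 s, S s & U [set H | completion_filter H (xsection w s)].
    apply: ultra_finite_cover fS _ => H.
    have [A HA Aq] := completion_small H eq; have [a Aa] := filter_ex HA.
    have [s Ss sa] := Sq a; exists s => //; apply: filterS HA => x Ax.
    by apply/xsectionP; apply: q3 sa (Aq (a, x) _) (entourage_refl _ eq).
  exists v, [set H | completion_filter H (xsection w s)]; split=> //.
    move=> [x y] [/= [H [A [/= Hs HA Av Ax]]] [H' [B [/= H's H'B Bv By]]]].
    have [z [Az /xsectionP sz]] := filter_ex (filterI HA Hs).
    have [t [Bt /xsectionP st]] := filter_ex (filterI H'B H's).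
    apply: v3 (Av (x, z) (conj Ax Az)) _ (Bv (t, y) (conj Bt By)).
    exact: w3 (wsym _ _ sz) st (entourage_refl _ ew).
  move=> H /= Hs; have [A HA Av] := completion_small H ev.
  by apply: (filterS _ HA) => x Ax; exists H, A.
have cF0 : cauchy_filter F0.
  apply: small_cauchy => u /smallF0 [v [P [ev UP Nu _]]].
  by exists (N v P) => //; exists (v, P).
have mF0 : minimal_cauchy_filter F0.
  apply: minimal_cauchy_round => // A [[u P] [/= eu UP] NA].
  have [v [ev vsym v3]] := entourage_sym_split3 eu.
  exists (N v P), v; split=> //; first by exists (v, P).
  move=> x y [H [B [PH HB Bv Bx]]] xy; apply: NA => /=.
  have vr z := entourage_refl z ev.
  exists H, (B `|` [set y]); split=> //; last by right.
    by apply: filterS HB => z; left.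
  move=> [a b] [/= [Ba|->] [Bb|->]].
  - exact: v3 (Bv (a, b) (conj Ba Bb)) (vr b) (vr b).
  - exact: v3 (Bv (a, x) (conj Ba Bx)) xy (vr y).
  - exact: v3 (vsym _ _ xy) (Bv (x, b) (conj Bx Bb)) (vr b).
  - exact: entourage_refl.
exists (Completion mF0); split=> //=; apply/cvg_entourageP => E [u eu uE].
have [v [P [ev UP Nu PN]]] := smallF0 u eu.
apply: (filterS _ UP) => H PH; apply: uE; exists (N v P); split=> //=; last exact: PN.
by exists (v, P).
Qed.

End Completion.

(** * The action on the completion *)

Section CompletionAction.
Context {G : groupType} {M : uniformType} {act : G -> M -> M}.
Hypotheses (actA : left_action act) (actU : preserves_uniformity act).
Local Notation cact := (completion_act actA actU).

Lemma completion_left_action : left_action cact.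
Proof.
split=> [F|g h F]; apply: completion_inj; rewrite /= /fmap.
  by apply/funext => A /=; congr completion_filter; apply/funext => x /=; rewrite actA.1.
by apply/funext => A /=; congr completion_filter; apply/funext => x /=; rewrite actA.2.
Qed.

Lemma completion_act_image g (F : completion M) A : completion_filter F A ->
  completion_filter (cact g F) (act g @` A).
Proof.
have := @completion_proper _ F => FF.
by rewrite /= /fmap /=; apply: filterS => x Ax; exists x.
Qed.

Lemma small_act_image g u A : small (pair_act act g^-1%g @` u) A ->
  small u (act g @` A).
Proof.
move=> Au [_ _] [/= [a Aa <-] [b Ab <-]].
by have [[c e] ce [<- <-]] := Au (a, b) (conj Aa Ab); rewrite !(actVK g actA).
Qed.

Lemma completion_act_continuous g : continuous (cact g).
Proof.
move=> F; apply/(@cvg_app_entourageP _ _ (cact g) (nbhs F) _ (cact g F)).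
move=> E [u eu uE].
have ev := actU g^-1%g eu.
have ecv : entourage (completion_rel (pair_act act g^-1%g @` u)).
  by exists (pair_act act g^-1%g @` u).
apply: filterS (nbhs_entourage F ecv) => H /xsectionP [A [/= FA HA Au]]; apply: uE.
exists (act g @` A); split; try exact: completion_act_image.
exact: small_act_image.
Qed.

Lemma completion_act_meets g F P :
  (forall D, completion_filter (cact g F) D -> D `&` P !=set0) ->
  forall D, completion_filter F D -> D `&` (act g @^-1` P) !=set0.
Proof.
move=> gFP D /(completion_act_image g)/gFP [_ [[x Dx <-] Px]].
by exists x.
Qed.

(** If [v] and [g v] are unlinked then [g] cannot map a uniformly separated
    triple to another: by the pigeonhole principle, two image points are adherent
    to the same small set of the cover. *)
Lemma dynkin_convergence (K : set (theta3 (completion M))) :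
  dynkin_property act -> compact K ->
  finite_set [set g : G | exists A B : theta3 (completion M),
    [/\ K A, K B & cact g @` A = B]].
Proof.
move=> dyn cK.
have [r [u eu ur] sepK] := compact_theta3_separated completion_hausdorff cK.
have [v [ev _ v3]] := entourage_sym_split3 eu.
apply: sub_finite_set (dyn v v ev ev) => g [A [B [KA KB gAB]]].
move=> [P [Q [PQ Pv Qv]]].
have [t dt tA] := theta3_setP A.
have Qv' : small v (act g @^-1` Q).
  move=> [x y] [/= Qx Qy]; have [[a b] ab [xa yb]] := Qv (_, _) (conj Qx Qy).
  by rewrite -(actKV g actA x) -xa -(actKV g actA y) -yb !(actKV g actA).
have [F|F [H [tF tH FH]]] := pigeonhole3
    (p := fun F => forall D, completion_filter (cact g F) D -> D `&` P !=set0)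
    (q := fun F => forall D, completion_filter (cact g F) D -> D `&` Q !=set0) dt.
  by apply: proper_meetsU PQ; exact: completion_proper.
rewrite tA in tF tH; case=> [[FP HP]|[FQ HQ]].
  have := meets_small_rel ev v3 Pv FP HP; move/ur; apply: (sepK B KB).
  - by rewrite -gAB; exists F.
  - by rewrite -gAB; exists H.
  - move=> E; apply: FH.
    by rewrite -(actKV g completion_left_action F) E (actKV g completion_left_action).
have := meets_small_rel ev v3 Qv' (completion_act_meets FQ) (completion_act_meets HQ).
by move/ur; apply: (sepK A KA).
Qed.

End CompletionAction.

(** * The proposition *)

Theorem proposition4p2p1 (G : groupType) (M : uniformType) (adj : rel M)
    (act : G -> M -> M)
    (adj_sym : symmetric adj) (adj_irr : irreflexive adj)
    (adj_conn : connected_graph adj)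
    (actA : left_action act)
    (act_adj : forall g x y, adj (act g x) (act g y) = adj x y)
    (act_proper : forall e, edges adj e ->
       finite_set [set g : G | act g @` e = e])
    (vis : visibility adj)
    (actU : preserves_uniformity act) :
  dynkin_property act /\ convergence_property (completion_act actA actU).
Proof.
have dyn : dynkin_property act by exact: visibility_dynkin act_adj act_proper vis.
split=> //; split.
- by apply: completion_compact; exact: visibility_totally_bounded vis.
- exact: completion_hausdorff.
- exact: completion_left_action.
- exact: completion_act_continuous.
- by move=> K; exact: dynkin_convergence.
Qed.
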